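(* Let $G$ be a finite group and let $V$ be a finite-dimensional $G$-module over $\mathbb{C}$ with character $\chi_V$. For $\lambda\in\Lambda(G)$, the Poincaré series $P^\lambda(t)=\sum_{k=0}^\infty (A^k)_{0,\lambda}\,t^k$ for the number of walks of $k$ steps from $0$ to $\lambda$ on the McKay quiver of $(G,V)$ (equivalently, for the multiplicities of $G_\lambda$ in the tensor powers $V^{\otimes k}$) is $$P^\lambda(t)=|G|^{-1}\sum_{\mu\in\Lambda(G)}|\mathcal{C}_\mu|\,\frac{\overline{\chi_\lambda(c_\mu)}}{1-\chi_V(c_\mu)t}=|G|^{-1}\sum_{g\in G}\frac{\overline{\chi_\lambda(g)}}{1-\chi_V(g)t}.$$ In particular, the Poincaré series for the tensor invariants $\bigoplus_{k\ge0}(V^{\otimes k})^G$ is $$P^0(t)=\sum_{k=0}^\infty\dim (V^{\otimes k})^G\,t^k=|G|^{-1}\sum_{\mu\in\Lambda(G)}|\mathcal{C}_\mu|\,\frac{1}{1-\chi_V(c_\mu)t}=|G|^{-1}\sum_{g\in G}\frac{1}{1-\chi_V(g)t}.$$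
   Context: $\Lambda(G)$ is a finite set indexing the irreducible complex $G$-modules $G_\lambda$ (with characters $\chi_\lambda$) up to isomorphism, and also the conjugacy classes of $G$; $0\in\Lambda(G)$ labels the trivial module. $c_\mu$ is a representative of the conjugacy class $\mathcal{C}_\mu$ labeled by $\mu$. The McKay quiver of $(G,V)$ is the directed multigraph with node set $\Lambda(G)$ having $a_{\nu,\lambda}$ arrows from $\nu$ to $\lambda$, where $a_{\nu,\lambda}$ is the multiplicity of $G_\lambda$ in $G_\nu\otimes V$; its adjacency matrix is $A=(a_{\nu,\lambda})$. Identities are between formal power series in $t$. *)

(* Defs.v *)
From HB Require Import structures.
From mathcomp Require Import all_boot all_order all_algebra all_fingroup.
From mathcomp Require Import mxrepresentation character.
From mathcomp Require Import boolp reals.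
From mathcomp.real_closed Require Import complex.

Set Implicit Arguments.
Unset Strict Implicit.
Unset Printing Implicit Defensive.

Import GRing.Theory.
Local Open Scope ring_scope.

(* The ring F[[t]] of formal power series. The type is wrapped in a record     *)
(* because functions nat -> F already carry the pointwise ring structure.      *)
Record fps (F : Type) := Fps { fps_coef : nat -> F }.

Section FormalPowerSeries.
Variable F : fieldType.
Implicit Types f g h : fps F.
Local Notation "f `_[ n ]" := (fps_coef f n)
  (at level 3, n at level 200, format "f `_[ n ]").

Lemma fpsP f g : (forall n, f`_[n] = g`_[n]) -> f = g.
Proof. by case: f g => [u] [v] /= /funext->. Qed.

HB.instance Definition _ := gen_eqMixin (fps F).
HB.instance Definition _ := gen_choiceMixin (fps F).

Definition fps_zero : fps F := Fps (fun _ => 0 : F).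
Definition fps_opp f : fps F := Fps (fun n => - f`_[n]).
Definition fps_add f g : fps F := Fps (fun n => f`_[n] + g`_[n]).

Fact fps_addA : associative fps_add.
Proof. by move=> f g h; apply: fpsP => n /=; rewrite addrA. Qed.
Fact fps_addC : commutative fps_add.
Proof. by move=> f g; apply: fpsP => n /=; rewrite addrC. Qed.
Fact fps_add0 : left_id fps_zero fps_add.
Proof. by move=> f; apply: fpsP => n /=; rewrite add0r. Qed.
Fact fps_addN : left_inverse fps_zero fps_opp fps_add.
Proof. by move=> f; apply: fpsP => n /=; rewrite addNr. Qed.

HB.instance Definition _ :=
  GRing.isZmodule.Build (fps F) fps_addA fps_addC fps_add0 fps_addN.

Definition fps_one : fps F := Fps (fun n => (n == 0%N)%:R : F).
Definition fps_mul f g : fps F :=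
  Fps (fun n => \sum_(i < n.+1) f`_[i] * g`_[(n - i)%N]).

Definition fps_trunc n f : {poly F} := \poly_(i < n.+1) f`_[i].

Fact coef_fps_trunc n f i : (i <= n)%N -> (fps_trunc n f)`_i = f`_[i] :> F.
Proof. by move=> le_in; rewrite coef_poly ltnS le_in. Qed.

Fact fps_mul_trunc n f g m : (m <= n)%N ->
  (fps_mul f g)`_[m] = (fps_trunc n f * fps_trunc n g)`_m :> F.
Proof.
move=> le_mn; rewrite coefM; apply: eq_bigr => -[i /=]; rewrite ltnS => le_im _.
rewrite !coef_fps_trunc ?(leq_trans le_im) //.
exact: leq_trans (leq_subr _ _) le_mn.
Qed.

Fact fps_mulC : commutative fps_mul.
Proof.
by move=> f g; apply: fpsP => n; rewrite (fps_mul_trunc f g (leqnn n)) mulrC -fps_mul_trunc.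
Qed.

Fact fps_mulA : associative fps_mul.
Proof.
move=> f g h; apply: fpsP => n.
transitivity (fps_trunc n f * fps_trunc n g * fps_trunc n h)`_n.
  rewrite -mulrA coefM; apply: eq_bigr => i _.
  by rewrite (fps_mul_trunc g h (leq_subr i n)) coef_fps_trunc // -ltnS.
rewrite coefM; apply: eq_bigr => i _; have le_in : (i <= n)%N by rewrite -ltnS.
by rewrite (fps_mul_trunc f g le_in) coef_fps_trunc ?leq_subr.
Qed.

Fact fps_mul1 : left_id fps_one fps_mul.
Proof.
move=> f; apply: fpsP => n /=; rewrite big_ord_recl subn0 mul1r big1 ?addr0 //.
by move=> i _; rewrite mul0r.
Qed.

Fact fps_mulDl : left_distributive fps_mul fps_add.
Proof.
move=> f g h; apply: fpsP => n /=; rewrite -big_split /=.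
by apply: eq_bigr => i _; rewrite mulrDl.
Qed.

Fact fps_one_neq0 : fps_one != 0.
Proof.
by apply/eqP => /(congr1 (fun f => f`_[0])) /eqP /=; rewrite oner_eq0.
Qed.

HB.instance Definition _ := GRing.Zmodule_isComNzRing.Build (fps F)
  fps_mulA fps_mulC fps_mul1 fps_mulDl fps_one_neq0.

Definition fps_unit : pred (fps F) := fun f => f`_[0] != 0.

(* The first n coefficients b_0, ..., b_(n-1) of the inverse of f, determined  *)
(* by f_0 b_0 = 1 and f_0 b_n = - \sum_(i < n) f_(n-i) b_i for n > 0.          *)
Fixpoint fps_inv_seq f n : seq F :=
  if n is m.+1 then
    let s := fps_inv_seq f m in
    rcons s (f`_[0]^-1 * ((m == 0%N)%:R - \sum_(i < m) f`_[(m - i)%N] * s`_i))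
  else [::].

Definition fps_inv f : fps F :=
  if fps_unit f then Fps (fun n => (fps_inv_seq f n.+1)`_n) else f.

Fact size_fps_inv_seq f n : size (fps_inv_seq f n) = n.
Proof. by elim: n => //= n IHn; rewrite size_rcons IHn. Qed.

Fact nth_fps_inv_seq f n i : (i < n)%N ->
  (fps_inv_seq f n)`_i = (fps_inv_seq f i.+1)`_i.
Proof.
elim: n => // n IHn; rewrite ltnS leq_eqVlt => /orP[/eqP-> //|lt_in].
by rewrite [in LHS]/= nth_rcons size_fps_inv_seq lt_in IHn.
Qed.

Fact fps_mulV : {in fps_unit, left_inverse 1 fps_inv *%R}.
Proof.
move=> f Uf; rewrite mulrC; apply: fpsP => n.
have f0 : f`_[0] != 0 by [].
rewrite /fps_inv (_ : fps_unit f) //.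
transitivity (\sum_(i < n.+1) f`_[(n - i)%N] * (fps_inv_seq f i.+1)`_i).
  change (\sum_(i < n.+1) f`_[i] * (fps_inv_seq f (n - i).+1)`_(n - i) =
     \sum_(i < n.+1) f`_[(n - i)%N] * (fps_inv_seq f i.+1)`_i).
  rewrite (reindex_inj rev_ord_inj) /=; apply: eq_bigr => -[i lt_in] _.
  by rewrite subSS subKn.
rewrite big_ord_recr /= subnn nth_rcons size_fps_inv_seq ltnn eqxx.
rewrite mulrA mulfV // mul1r addrC -addrA -[RHS]addr0; congr (_ + _).
apply/eqP; rewrite addrC subr_eq0; apply/eqP.
by apply: eq_bigr => i _; rewrite -(nth_fps_inv_seq f (ltn_ord i)).
Qed.

Fact fps_unitP f g : g * f = 1 -> fps_unit f.
Proof.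
move/(congr1 (fun h => h`_[0])) => /=; rewrite big_ord1 subn0 => gf1.
by apply: contra_eq_neq gf1 => ->; rewrite mulr0 eq_sym oner_neq0.
Qed.

Fact fps_inv_out : {in [predC fps_unit], fps_inv =1 id}.
Proof.
by move=> f nUf; rewrite /fps_inv ifN.
Qed.

HB.instance Definition _ := GRing.ComNzRing_hasMulInverse.Build (fps F)
  fps_mulV fps_unitP fps_inv_out.

Definition fps_scale (a : F) f : fps F := Fps (fun n => a * f`_[n]).

Fact fps_scaleA a b f : fps_scale a (fps_scale b f) = fps_scale (a * b) f.
Proof. by apply: fpsP => n /=; rewrite mulrA. Qed.
Fact fps_scale1 : left_id 1 fps_scale.
Proof. by move=> f; apply: fpsP => n /=; rewrite mul1r. Qed.
Fact fps_scaleDr : right_distributive fps_scale +%R.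
Proof. by move=> a f g; apply: fpsP => n /=; rewrite mulrDr. Qed.
Fact fps_scaleDl f : {morph fps_scale^~ f : a b / a + b}.
Proof. by move=> a b; apply: fpsP => n /=; rewrite mulrDl. Qed.

HB.instance Definition _ := GRing.Zmodule_isLmodule.Build F (fps F)
  fps_scaleA fps_scale1 fps_scaleDr fps_scaleDl.

Fact fps_scaleAl (a : F) f g : a *: (f * g) = (a *: f) * g.
Proof.
by apply: fpsP => n /=; rewrite mulr_sumr; apply: eq_bigr => i _; rewrite mulrA.
Qed.

HB.instance Definition _ :=
  GRing.Lmodule_isLalgebra.Build F (fps F) fps_scaleAl.

Definition fpsX : fps F := Fps (fun n => (n == 1%N)%:R).

End FormalPowerSeries.

Arguments fpsX {F}.

Section Modules.
Variables (F : fieldType) (gT : finGroupType) (G : {group gT}).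

Fact triv_mx_repr : mx_repr G (fun _ : gT => 1%:M : 'M[F]_1).
Proof. by split=> // x y _ _; rewrite mulmx1. Qed.

Definition triv_grepr : representation F G :=
  Representation (MxRepresentation triv_mx_repr).

Definition prod_grepr (U V : representation F G) : representation F G :=
  Representation (prod_repr U V).

Definition tensor_power (V : representation F G) (k : nat) :=
  iter k (fun U => prod_grepr U V) triv_grepr.

Definition repr_char (V : representation F G) (g : gT) : F := \tr (V g).

Definition dim_invariants (V : representation F G) : nat :=
  \rank (rfix_mx V G).

Definition irr_labelling (N : nat) (irr : 'I_N -> representation F G)
    (zero : 'I_N) : Prop :=
  [/\ forall lam, mx_irreducible (irr lam),
      forall lam mu, mx_rsim (irr lam) (irr mu) -> lam = mu,
      forall U : representation F G,
        mx_irreducible U -> exists lam, mx_rsim U (irr lam)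
    & mx_rsim (irr zero) triv_grepr].

Definition class_labelling (N : nat) (c : 'I_N -> gT) : Prop :=
  injective (fun mu => (c mu ^: G)%g)
  /\ [set (c mu ^: G)%g | mu : 'I_N] = classes G.

End Modules.

(* The multiplicity of a simple module S in M, read off the decomposition of M *)
(* into isotypic components W: at most one of them is of type S, and the sum   *)
(* is 0 if there is none.                                                      *)
Definition multiplicity (F : decFieldType) (gT : finGroupType) (G : {group gT})
    (S M : representation F G) : nat :=
  \sum_(W : DecSocleType M | `[< mx_rsim S (socle_repr W) >]) socle_mult W.

Definition mckay_adj (F : decFieldType) (gT : finGroupType) (G : {group gT})
    (N : nat) (irr : 'I_N -> representation F G) (V : representation F G) :
    'M[nat]_N :=
  \matrix_(nu, lam) multiplicity (irr lam) (prod_grepr (irr nu) V).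

(* An arrow of the directed multigraph on 'I_N with adjacency matrix A: its    *)
(* (source, target), together with one of the A source target parallel arrows. *)
Definition arrow (N : nat) (A : 'M[nat]_N) :=
  {e : 'I_N * 'I_N & 'I_(A e.1 e.2)}.

Fixpoint is_walk (N : nat) (A : 'M[nat]_N) (u : 'I_N) (w : seq (arrow A))
    (v : 'I_N) : bool :=
  if w is a :: w' then ((tag a).1 == u) && is_walk (tag a).2 w' v else u == v.

Definition num_walks (N : nat) (A : 'M[nat]_N) (k : nat) (u v : 'I_N) : nat :=
  #|[set w : k.-tuple (arrow A) | is_walk u w v]|.

Definition poincare_series (F : decFieldType) (gT : finGroupType)
    (G : {group gT}) (N : nat) (irr : 'I_N -> representation F G)
    (zero : 'I_N) (V : representation F G) (lam : 'I_N) : fps F :=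
  Fps (fun k => ((mckay_adj irr V ^+ k) zero lam)%:R).

(* Main.v *)
Require Import Defs.
From mathcomp Require Import all_boot all_order all_algebra all_fingroup.
From mathcomp Require Import mxrepresentation character.
From mathcomp Require Import boolp reals.
From mathcomp.real_closed Require Import complex.

Set Implicit Arguments.
Unset Strict Implicit.
Unset Printing Implicit Defensive.

Import GRing.Theory Num.Theory.
Local Open Scope ring_scope.

(* The multiplicity of a simple module S in M is the character inner product   *)
(* <chi_M, chi_S>: Maschke's theorem decomposes chi_M, and Schur's lemma       *)
(* applied to averaged elementary matrices gives the orthogonality relations.  *)
(* Decomposing V^{(x)k} into simple modules then turns the recursion           *)
(*   (A^{k+1})_{0,lam} = \sum_nu (A^k)_{0,nu} a_{nu,lam}                       *)
(* into the multiplicities of G_lam in V^{(x)k}, that is, into                 *)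
(*   |G|^-1 \sum_g chi_V(g)^k (chi_lam(g))^*,                                  *)
(* and the series in k is a sum of geometric series.                           *)

(** The identity is checked coefficient by coefficient in t. Tensoring with V acts on multiplicities
    as multiplication by A, so [mckay_adj_pow] identifies (A^k)_{0,lam} with a multiplicity in the
    k-th tensor power. By [multiplicity_char_dot] this is an inner product of characters, whose only
    dependence on k is the factor chi_V(g)^k; [fps_geom] then sums over k for each fixed g. Three
    side results complete the statement: [num_walksE] counts walks by powers of A,
    [sum_class_labelling] trades sums over G for sums over classes, and [dim_invariants_char_dot]
    treats the invariants. *)

Section MatrixFacts.
Variable F : fieldType.

(** In a full-rank factorization E = C R, cancelling C on the left and R on the right of C R C R = C
    R leaves R C = 1, of size the rank, and tr(C R) = tr(R C). *)
Lemma mxtrace_idempotent n (E : 'M[F]_n) : E *m E = E -> \tr E = (\rank E)%:R.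
Proof.
move=> EE; suff RC1 : row_base E *m col_base E = 1%:M.
  by rewrite -[in LHS](mulmx_base E) mxtrace_mulC RC1 mxtrace1.
have [C' C'K] := row_fullP (col_base_full E).
have [R' RK] := row_freeP (row_base_free E).
move: (mulmx_base E) C'K RK; move: (col_base E) (row_base E) => C R CRE C'K RK.
have CRCR : C *m R *m (C *m R) = C *m R by rewrite CRE.
have := congr1 (fun X => C' *m X *m R') CRCR; rewrite !mulmxA C'K mul1mx.
by rewrite -[R *m C *m _ *m _]mulmxA RK mulmx1.
Qed.

(** Entry (i, j) of A e_ij B is A_ii B_jj. This form lets a sum of products of traces over G become
    entries of averaged intertwiners. *)
Lemma mxtrace_mul_delta m n (A : 'M[F]_m) (B : 'M[F]_n) :
  \tr A * \tr B = \sum_i \sum_j (A *m delta_mx i j *m B) i j.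
Proof.
rewrite /mxtrace mulr_suml; apply: eq_bigr => i _.
rewrite mulr_sumr; apply: eq_bigr => j _.
rewrite -(mul_delta_mx (0 : 'I_1)) mulmxA -colE -mulmxA -rowE.
by rewrite mxE big_ord1 !mxE.
Qed.

Variables (gT : finGroupType) (G : {group gT}).

(** Schur's lemma: the kernel and the image of f are submodules, so a nonzero f is both injective
    and surjective. *)
Lemma intertwiner_rsim n1 n2 (rG1 : mx_representation F G n1)
    (rG2 : mx_representation F G n2) (f : 'M_(n1, n2)) :
  mx_irreducible rG1 -> mx_irreducible rG2 ->
  (forall x, x \in G -> rG1 x *m f = f *m rG2 x) -> f != 0 -> mx_rsim rG1 rG2.
Proof.
move=> /mx_irrP[_ irr1] /mx_irrP[_ irr2] homf nzf.
have freef : row_free f.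
  rewrite -kermx_eq0; apply: contraNT nzf => nzker.
  have /irr1/(_ nzker) : mxmodule rG1 (kermx f).
    apply/mxmoduleP=> x Gx; apply/sub_kermxP.
    by rewrite -mulmxA homf // mulmxA mulmx_ker mul0mx.
  by rewrite -sub1mx => /sub_kermxP; rewrite mul1mx => ->.
have fullf : row_full f.
  rewrite /row_full -mxrank_gen; apply: irr2; last first.
    by rewrite -mxrank_eq0 mxrank_gen mxrank_eq0.
  rewrite (eqmx_module _ (genmxE f)); apply/mxmoduleP=> x Gx.
  by rewrite -homf // submxMl.
by exists f => //; rewrite -(eqP freef) (eqP fullf).
Qed.

Definition avg_intertwiner n1 n2 (rG1 : mx_representation F G n1)
    (rG2 : mx_representation F G n2) (Z : 'M_(n1, n2)) : 'M_(n1, n2) :=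
  \sum_(x in G) rG1 x^-1%g *m Z *m rG2 x.

Lemma avg_intertwinerP n1 n2 (rG1 : mx_representation F G n1)
    (rG2 : mx_representation F G n2) (Z : 'M_(n1, n2)) y :
  y \in G ->
  rG1 y *m avg_intertwiner rG1 rG2 Z = avg_intertwiner rG1 rG2 Z *m rG2 y.
Proof.
move=> Gy; rewrite mulmx_sumr mulmx_suml.
rewrite (reindex_acts 'R _ Gy) ?astabsR //=.
apply: eq_bigr => x Gx; rewrite -!mulmxA -repr_mxM // !mulmxA -repr_mxM ?groupV //=.
  by rewrite invMg mulKVg.
by rewrite groupM.
Qed.

Lemma sum_mxtrace_avg n1 n2 (rG1 : mx_representation F G n1)
    (rG2 : mx_representation F G n2) :
  \sum_(x in G) \tr (rG1 x^-1%g) * \tr (rG2 x) =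
    \sum_i \sum_j avg_intertwiner rG1 rG2 (delta_mx i j) i j.
Proof.
under eq_bigr => x _ do rewrite mxtrace_mul_delta.
rewrite exchange_big; apply: eq_bigr => i _.
rewrite exchange_big; apply: eq_bigr => j _.
by rewrite summxE.
Qed.

End MatrixFacts.

(** * Orthogonality of characters, multiplicities and invariants *)

Section Orthogonality.
Variables (F : numClosedFieldType) (gT : finGroupType) (G : {group gT}).
Implicit Types U V S : representation F G.

Lemma repr_pchar : pgroup.pgroup [pchar F]^' G.
Proof. by apply: sub_in_pnat (pnat_pi _) => // p _ _; rewrite inE /= pchar_num. Qed.

Lemma card_neq0 : #|G|%:R != 0 :> F.
Proof. by rewrite pnatr_eq0 -lt0n cardG_gt0. Qed.

Lemma repr_charJ V g x : g \in G -> x \in G ->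
  repr_char V (g ^ x)%g = repr_char V g.
Proof.
move=> Gg Gx; rewrite /repr_char conjgE repr_mxM ?groupV ?groupM //.
by rewrite mxtrace_mulC -repr_mxM ?groupV ?groupM ?mulgK.
Qed.

Local Notation "A ^*T" := (map_mx Num.conj A^T) (at level 2, format "A ^*T").

(** The diagonal entries of the sum are sums of squared moduli, so each modulus vanishes. *)
Lemma sum_mulmx_conj_tr_eq0 (I : finType) (P : pred I) m n
    (A : I -> 'M[F]_(m, n)) :
  \sum_(x | P x) A x *m (A x)^*T = 0 -> forall x, P x -> A x = 0.
Proof.
move=> AA0 x Px; apply/matrixP=> i j; rewrite mxE; apply/eqP.
have norm0 : \sum_(y | P y) \sum_k `|A y i k| ^+ 2 = 0.
  transitivity ((\sum_(y | P y) A y *m (A y)^*T) i i); last by rewrite AA0 mxE.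
  rewrite summxE; apply: eq_bigr => y _.
  by rewrite mxE; apply: eq_bigr => k _; rewrite !mxE normCK.
have sq_ge0 y k : 0 <= `|A y i k| ^+ 2 by apply: exprn_ge0.
have row_ge0 y : P y -> 0 <= \sum_k `|A y i k| ^+ 2 by move=> _; apply: sumr_ge0.
have row0 := psumr_eq0P row_ge0 norm0 Px.
suff: `|A x i j| ^+ 2 == 0 by rewrite expf_eq0 /= normr_eq0.
by apply/eqP; apply: (psumr_eq0P (P := xpredT)) row0 _ _.
Qed.

(* The averaged Hermitian form H = \sum_x V x (V x)^* is positive definite and *)
(* G-invariant, so V g^-1 is conjugate, by H, to the adjoint of V g.           *)
Lemma repr_charV V g : g \in G -> repr_char V g^-1%g = (repr_char V g)^*.
Proof.
move=> Gg; pose H := \sum_(x in G) V x *m (V x)^*T.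
have VH : V g *m H *m (V g)^*T = H.
  rewrite mulmx_sumr mulmx_suml [RHS](reindex_inj (mulgI g)) /=.
  apply: eq_big => [x|x Gx]; first by rewrite groupMl.
  by rewrite repr_mxM // trmx_mul map_mxM !mulmxA.
have uH : H \in unitmx.
  rewrite -row_free_unit -kermx_eq0; set K := kermx H.
  (* Definiteness of H: K H K^* = 0 forces every K V x to vanish, and x = 1 gives K = 0. *)
  have KH0 : \sum_(x in G) (K *m V x) *m (K *m V x)^*T = 0.
    transitivity (K *m H *m K^*T); last by rewrite mulmx_ker mul0mx.
    rewrite mulmx_sumr mulmx_suml; apply: eq_bigr => x _.
    by rewrite trmx_mul map_mxM !mulmxA.
  have /(_ 1%g (group1 G)) := sum_mulmx_conj_tr_eq0 KH0.
  by rewrite repr_mx1 mulmx1 => ->.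
have HVV : H *m (V g)^*T = V g^-1%g *m H.
  by rewrite -[in RHS]VH !mulmxA -repr_mxM ?groupV ?mulVg ?repr_mx1 ?mul1mx.
rewrite /repr_char -[V g^-1%g](mulmxK uH) -HVV mxtrace_mulC mulKmx //.
rewrite -map_trmx mxtrace_tr /mxtrace raddf_sum.
by apply: eq_bigr => i _; rewrite mxE.
Qed.

Definition char_dot U V : F :=
  #|G|%:R^-1 * \sum_(g in G) repr_char U g * (repr_char V g)^*.

Lemma eq_char_dotl U U' V :
  {in G, repr_char U =1 repr_char U'} -> char_dot U V = char_dot U' V.
Proof. by move=> eqU; congr (_ * _); apply: eq_bigr => g Gg; rewrite eqU. Qed.

Lemma repr_char_rsim U V : mx_rsim U V -> {in G, repr_char U =1 repr_char V}.
Proof. exact: mxtrace_rsim. Qed.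

Lemma char_dot_avg U V :
  char_dot U V =
    #|G|%:R^-1 * \sum_i \sum_j avg_intertwiner V U (delta_mx i j) i j.
Proof.
congr (_ * _); rewrite -sum_mxtrace_avg; apply: eq_bigr => g Gg.
by rewrite -[\tr (V _)]/(repr_char V _) repr_charV // mulrC.
Qed.

Lemma char_dot_not_rsim U V : mx_irreducible U -> mx_irreducible V ->
  ~ mx_rsim V U -> char_dot U V = 0.
Proof.
move=> irrU irrV nsim; rewrite char_dot_avg big1 ?mulr0 // => i _.
rewrite big1 // => j _; set f := avg_intertwiner _ _ _.
have [-> | nzf] := eqVneq f 0; first by rewrite mxE.
by case: nsim; apply: intertwiner_rsim nzf => // x; apply: avg_intertwinerP.
Qed.

(** Over an algebraically closed field the average of e_ij is a scalar matrix. Its trace is |G|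
    tr(e_ij), so the scalar is |G|/n if i = j and 0 otherwise; the n diagonal terms add up to
    |G|. *)
Lemma char_dot_irr V : mx_irreducible V -> char_dot V V = 1.
Proof.
move=> irrV; have [n_gt0 _] := (mx_irrP V).1 irrV.
have nz_n : (rdegree V)%:R != 0 :> F by rewrite pnatr_eq0 -lt0n.
rewrite char_dot_avg (eq_bigr (fun=> #|G|%:R / (rdegree V)%:R)) => [|i _].
  rewrite sumr_const card_ord -[_ *+ rdegree V]mulr_natr divfK // mulVf //.
  exact: card_neq0.
have avgE j : avg_intertwiner V V (delta_mx i j) i j
    = (i == j)%:R * (#|G|%:R / (rdegree V)%:R).
  have /is_scalar_mxP[a defa] : is_scalar_mx (avg_intertwiner V V (delta_mx i j)).
    apply: (mx_abs_irr_cent_scalar (rG := V)).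
      exact: group_closure_closed_field.
    by apply/centgmxP=> x Gx; rewrite avg_intertwinerP.
  have := congr1 mxtrace defa; rewrite mxtrace_scalar => tr_a; rewrite {}defa mxE.
  have -> : a = (i == j)%:R * #|G|%:R / (rdegree V)%:R.
    apply: (canRL (mulfK nz_n)); rewrite [a * _]mulr_natr -tr_a raddf_sum /=.
    rewrite (eq_bigr (fun=> (i == j)%:R)) => [|x Gx]; last first.
      rewrite mxtrace_mulC mulmxA -repr_mxM ?groupV // mulgV repr_mx1 mul1mx.
      rewrite /mxtrace (bigD1 i) //= big1 => [|k ne_ki]; rewrite !mxE.
        by rewrite eqxx addr0 eq_sym.
      by rewrite (negPf ne_ki).
    by rewrite sumr_const mulr_natr.
  by case: eqP => _; rewrite !(mul1r, mul0r, mul0rn, mulr1n).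
rewrite (bigD1 i) //= big1 ?addr0 ?avgE ?eqxx ?mul1r // => j ne_ji.
by rewrite avgE eq_sym (negPf ne_ji) mul0r.
Qed.

Lemma repr_char_socle V : {in G, forall g,
  repr_char V g = \sum_(W : DecSocleType V) \tr (socle_repr W g) *+ socle_mult W}.
Proof.
move=> g Gg; rewrite -mxtrace_Socle // mxtrace_submod1 //.
by rewrite reducible_Socle1 //; apply/mx_Maschke_pchar/repr_pchar.
Qed.

(** Pairing the isotypic decomposition of chi_V with chi_S, orthogonality keeps exactly the
    components of type S. *)
Lemma multiplicity_char_dot S V : mx_irreducible S ->
  (multiplicity S V)%:R = char_dot V S.
Proof.
move=> irrS.
have dotW W : char_dot (Representation (@socle_repr _ _ _ _ V (DecSocleType V) W)) S
    = (`[< mx_rsim S (socle_repr W) >])%:R.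
  case: asboolP => simSW; last first.
    by apply: char_dot_not_rsim => //; apply: socle_irr.
  rewrite -(char_dot_irr irrS); apply: eq_char_dotl => g Gg.
  exact: mxtrace_rsim (mx_rsim_sym simSW) g Gg.
rewrite natr_sum big_mkcond; transitivity (\sum_(W : DecSocleType V)
  char_dot (Representation (socle_repr W)) S *+ socle_mult W).
  apply: eq_bigr => W _; rewrite dotW.
  by case: asboolP => _; rewrite ?mul0rn.
rewrite /char_dot; under eq_bigr => W _ do rewrite -mulrnAr.
rewrite -mulr_sumr; congr (_ * _); under eq_bigr => W _ do rewrite -sumrMnl.
rewrite exchange_big; apply: eq_bigr => g Gg.
rewrite (repr_char_socle V Gg) mulr_suml; apply: eq_bigr => W _.
by rewrite mulrnAl.
Qed.

Lemma repr_char_triv : repr_char (triv_grepr F G) =1 fun=> 1.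
Proof. by move=> g; rewrite /repr_char mxtrace1. Qed.

Lemma repr_char_prod U V g :
  repr_char (prod_grepr U V) g = repr_char U g * repr_char V g.
Proof. exact: mxtrace_prod. Qed.

Lemma repr_char_tensor_power V k g :
  repr_char (tensor_power V k) g = repr_char V g ^+ k.
Proof.
elim: k => [|k IHk]; first exact: repr_char_triv.
by rewrite exprSr -IHk -repr_char_prod.
Qed.

(* |G|^-1 \sum_(g in G) V g is a projection onto the invariants. *)
Lemma dim_invariants_char_dot V :
  (dim_invariants V)%:R = char_dot V (triv_grepr F G).
Proof.
pose E := #|G|%:R^-1 *: \sum_(g in G) V g.
have fixE : (E <= rfix_mx V G)%MS.
  apply/rfix_mxP=> g Gg; rewrite -scalemxAl; congr (_ *: _).
  rewrite mulmx_suml [RHS](reindex_acts 'R _ Gg) ?astabsR //=.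
  by apply: eq_bigr => x Gx; rewrite repr_mxM.
have Efix m (W : 'M_(m, rdegree V)) : (W <= rfix_mx V G)%MS -> W *m E = W.
  move=> /rfix_mxP fixW; rewrite -scalemxAr mulmx_sumr (eq_bigr _ fixW).
  by rewrite sumr_const -scaler_nat scalerA mulVf ?scale1r // card_neq0.
(* The image of E consists of invariants, and E fixes every invariant, so the two row spaces
   coincide. *)
have -> : dim_invariants V = \rank E.
  apply/esym/eqP; rewrite mxrank_leqif_eq //; apply/andP; split=> //.
  by rewrite -(Efix _ _ (submx_refl _)) submxMl.
rewrite -mxtrace_idempotent ?Efix // mxtraceZ raddf_sum; congr (_ * _).
by apply: eq_bigr => g _; rewrite repr_char_triv rmorph1 mulr1.
Qed.
End Orthogonality.

(** * Counting walks by powers of the adjacency matrix *)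

Section Walks.
Variables (N : nat) (A : 'M[nat]_N).

Lemma num_walks0 u v : num_walks A 0 u v = (u == v).
Proof.
rewrite /num_walks cardsE; case: eqVneq => [->|ne_uv].
  by rewrite (eq_card1 (x := [tuple])) // => w; rewrite (tuple0 w) inE; exact: eqxx.
by rewrite eq_card0 // => w; rewrite (tuple0 w); exact: negPf.
Qed.

Lemma num_walksS k u v :
  num_walks A k.+1 u v = (\sum_x A u x * num_walks A k x v)%N.
Proof.
pose F (a : arrow A) := num_walks A k (tag a).2 v.
transitivity (\sum_(a : arrow A | (tag a).1 == u) F a)%N.
  rewrite /num_walks -sum1dep_card.
  (* Split off the first arrow of the walk. *)
  rewrite (reindex (fun p : arrow A * k.-tuple (arrow A) => cons_tuple p.1 p.2)).
    rewrite /F /num_walks; under [RHS]eq_bigr => a _ do rewrite -sum1dep_card.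
    by rewrite pair_big_dep.
  exists (fun w => (thead w, [tuple of behead w])) => [[a w] _|w _] /=.
    by rewrite theadE; congr (_, _); apply: val_inj.
  by apply: val_inj; case/tupleP: w.
(* Arrows are grouped by their endpoints; parallel arrows contribute equally. *)
have -> : (\sum_(a : arrow A | (tag a).1 == u) F a =
    \sum_(e : 'I_N * 'I_N | e.1 == u) \sum_(i < A e.1 e.2) num_walks A k e.2 v)%N.
  rewrite (sig_big_dep (fun e : 'I_N * 'I_N => e.1 == u) _
     (fun e (_ : 'I_(A e.1 e.2)) => num_walks A k e.2 v)) /=.
  by apply: eq_bigl => a; rewrite andbT.
transitivity (\sum_(y | y == u) \sum_x \sum_(i < A y x) num_walks A k x v)%N.
  by rewrite pair_big_dep; apply: eq_bigl => e; rewrite andbT.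
rewrite big_pred1_eq.
by apply: eq_bigr => x _; rewrite sum_nat_const card_ord.
Qed.

Lemma num_walksE k u v : num_walks A k u v = (A ^+ k) u v.
Proof.
elim: k u => [|k IHk] u; first by rewrite num_walks0 expr0 mxE; case: eqP.
by rewrite num_walksS exprS -mulmxE mxE; apply: eq_bigr => x _; rewrite IHk.
Qed.

End Walks.

(** * Geometric series in F[[t]] *)

Section GeometricSeries.
Variable F : fieldType.

Lemma fps_geom (a : F) : (1 - a *: fpsX)^-1 = Fps (fun n => a ^+ n).
Proof.
have geomK : Fps (fun n => a ^+ n) * (1 - a *: fpsX) = 1.
  rewrite mulrBr mulr1 mulrC -scalerAl; apply: fpsP => -[|n] /=.
    by rewrite big_ord1 mul0r mulr0 subr0.
  rewrite !big_ord_recl /= subSS subn0 big1 => [|i _]; last by rewrite mul0r.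
  by rewrite mul0r add0r mul1r addr0 -exprS subn0 subrr.
have U : (1 - a *: fpsX : fps F) \is a GRing.unit.
  by apply/unitrP; eexists; split; [exact: geomK | rewrite mulrC].
by apply: (mulIr U); rewrite mulVr.
Qed.

Lemma fps_coef_sum (I : Type) (r : seq I) (P : pred I) (f : I -> fps F) n :
  fps_coef (\sum_(i <- r | P i) f i) n = \sum_(i <- r | P i) fps_coef (f i) n.
Proof. exact: (big_morph (fun f => fps_coef f n) (fun _ _ => erefl) erefl). Qed.

Lemma fps_coef_scale_geom (b a : F) n :
  fps_coef (b%:A / (1 - a *: fpsX)) n = b * a ^+ n.
Proof. by rewrite fps_geom -scalerAl mul1r. Qed.

End GeometricSeries.

(** The classes partition G, the labelling lists each of them once, and f is constant on each. *)
Lemma sum_class_labelling (gT : finGroupType) (G : {group gT}) (N : nat)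
    (c : 'I_N -> gT) (M : nmodType) (f : gT -> M) :
  class_labelling G c -> {in G &, forall g x, f (g ^ x)%g = f g} ->
  \sum_(mu < N) f (c mu) *+ #|(c mu ^: G)%g| = \sum_(g in G) f g.
Proof.
move=> [inj_c defG] fJ.
have Gc mu : c mu \in G.
  have : (c mu ^: G)%g \in classes G by rewrite -defG; apply: imset_f.
  case/imsetP=> x Gx /class_eqP; apply/subsetP; exact: class_subG.
rewrite (set_partition_big _ (classes_partition G)) -defG big_imset /=; last first.
  by move=> mu nu _ _; apply: inj_c.
apply: eq_big => [mu | mu _]; first by rewrite inE.
rewrite -sumr_const; apply: eq_bigr => _ /imsetP[x Gx ->].
by rewrite fJ.
Qed.

(** * The McKay matrix and the Poincaré series *)

Section McKay.
Variables (F : numClosedFieldType) (gT : finGroupType) (G : {group gT}).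
Variables (N : nat) (irr : 'I_N -> representation F G) (zero : 'I_N).
Hypothesis hirr : irr_labelling irr zero.
Implicit Types U V : representation F G.

Lemma repr_char_multiplicity U : {in G, forall g,
  repr_char U g = \sum_nu (multiplicity (irr nu) U)%:R * repr_char (irr nu) g}.
Proof.
move=> g Gg; have [irr_irr irr_inj irr_surj _] := hirr.
rewrite (repr_char_socle U Gg).
under [RHS]eq_bigr => nu _ do
  rewrite /multiplicity natr_sum mulr_suml big_mkcond /=.
rewrite exchange_big; apply: eq_bigr => W _ /=.
have [nu simW] := irr_surj (Representation (socle_repr W)) (socle_irr W).
(* Each isotypic component matches exactly one label, since distinct labels are non-isomorphic. *)
rewrite (bigD1 nu) //= big1 => [|lam ne_lam]; last first.
  case: asboolP => // sim_lam; case/eqP: ne_lam.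
  exact/irr_inj/(mx_rsim_trans sim_lam).
case: asboolP => [_ | []]; last exact: mx_rsim_sym.
by rewrite addr0 mulr_natl (mxtrace_rsim simW).
Qed.

Lemma multiplicity_triv lam :
  multiplicity (irr lam) (triv_grepr F G) = (zero == lam).
Proof.
have [irr_irr irr_inj _ irr0] := hirr; apply/eqP; rewrite -(eqr_nat F); apply/eqP.
rewrite multiplicity_char_dot // -(eq_char_dotl _ (repr_char_rsim irr0)).
case: eqVneq => [<- | ne_lam]; first by rewrite char_dot_irr.
rewrite char_dot_not_rsim // => /irr_inj eq_lam.
by rewrite eq_lam eqxx in ne_lam.
Qed.

(** By induction the (A^k)_{0,nu} are the coefficients of chi_V^k in the irreducible characters;
    multiplying by chi_V and pairing with chi_lam gives one more factor A. *)
Lemma mckay_adj_pow V k lam :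
  (mckay_adj irr V ^+ k) zero lam = multiplicity (irr lam) (tensor_power V k).
Proof.
have [irr_irr _ _ _] := hirr.
elim: k lam => [|k IHk] lam; first by rewrite expr0 mxE multiplicity_triv; case: eqP.
(* In characteristic 0 natural numbers may be compared in F, where multiplicities are inner
   products. *)
apply/eqP; rewrite -(eqr_nat F); apply/eqP; rewrite exprSr -mulmxE mxE natr_sum.
under eq_bigr => nu _ do
  rewrite natrM IHk mxE (multiplicity_char_dot _ (irr_irr lam)) /char_dot
    mulrCA mulr_sumr.
rewrite -mulr_sumr exchange_big multiplicity_char_dot //; congr (_ * _).
apply: eq_bigr => g Gg.
rewrite -[tensor_power V k.+1]/(prod_grepr (tensor_power V k) V).
rewrite repr_char_prod (repr_char_multiplicity (tensor_power V k) Gg) !mulr_suml.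
by apply: eq_bigr => nu _; rewrite repr_char_prod !mulrA.
Qed.

Lemma poincare_seriesE V lam :
  poincare_series irr zero V lam =
    Fps (fun k => char_dot (tensor_power V k) (irr lam)).
Proof.
have [irr_irr _ _ _] := hirr.
by apply: fpsP => k /=; rewrite mckay_adj_pow multiplicity_char_dot.
Qed.

Lemma repr_char_zero : {in G, repr_char (irr zero) =1 fun=> 1}.
Proof.
move=> g Gg; have [_ _ _ irr0] := hirr.
by rewrite (repr_char_rsim irr0 Gg) repr_char_triv.
Qed.

Lemma poincare_series_sum V lam :
  poincare_series irr zero V lam = (#|G|%:R)^-1 *:
    \sum_(g in G) ((repr_char (irr lam) g)^*%:A / (1 - repr_char V g *: fpsX)).
Proof.
rewrite poincare_seriesE; apply: fpsP => k /=; rewrite fps_coef_sum.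
congr (_ * _); apply: eq_bigr => g _.
by rewrite fps_coef_scale_geom repr_char_tensor_power mulrC.
Qed.

Lemma poincare_series_sum_classes (c : 'I_N -> gT) V lam :
  class_labelling G c ->
  poincare_series irr zero V lam = (#|G|%:R)^-1 *:
    \sum_(mu < N) #|(c mu ^: G)%g|%:R *:
      ((repr_char (irr lam) (c mu))^*%:A / (1 - repr_char V (c mu) *: fpsX)).
Proof.
move=> hc; rewrite poincare_series_sum; congr (_ *: _).
rewrite -(sum_class_labelling hc) => [|g x Gg Gx]; last by rewrite !repr_charJ.
by apply: eq_bigr => mu _; rewrite scaler_nat.
Qed.

End McKay.

Theorem mainTheorem4 (R : realType) (gT : finGroupType) (G : {group gT})
    (N : nat) (irr : 'I_N -> representation R[i] G) (zero : 'I_N)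
    (hirr : irr_labelling irr zero)
    (c : 'I_N -> gT) (hc : class_labelling G c)
    (V : representation R[i] G) :
  let A := mckay_adj irr V in
  let P := poincare_series irr zero V in
  (forall lam : 'I_N,
    [/\ forall k, num_walks A k zero lam = (A ^+ k) zero lam,
        forall k, (A ^+ k) zero lam = multiplicity (irr lam) (tensor_power V k),
        P lam = (#|G|%:R)^-1 *:
          \sum_(mu < N) #|(c mu ^: G)%g|%:R *:
            ((repr_char (irr lam) (c mu))^*%:A
               / (1 - repr_char V (c mu) *: fpsX))
      & P lam = (#|G|%:R)^-1 *:
          \sum_(g in G) ((repr_char (irr lam) g)^*%:A
                           / (1 - repr_char V g *: fpsX))])
  /\
  [/\ P zero = Fps (fun k => (dim_invariants (tensor_power V k))%:R),
      P zero = (#|G|%:R)^-1 *: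
        \sum_(mu < N) #|(c mu ^: G)%g|%:R *:
          (1 / (1 - repr_char V (c mu) *: fpsX))
    & P zero = (#|G|%:R)^-1 *:
        \sum_(g in G) (1 / (1 - repr_char V g *: fpsX))].
Proof.
move=> A P; have P_sum := poincare_series_sum hirr V.
have P0_sum : P zero = (#|G|%:R)^-1 *:
    \sum_(g in G) (1 / (1 - repr_char V g *: fpsX)).
  rewrite /P P_sum; congr (_ *: _); apply: eq_bigr => g Gg.
  by rewrite (repr_char_zero hirr Gg) rmorph1 scale1r.
split=> [lam |].
  split=> [k | k ||]; [exact: num_walksE | exact: mckay_adj_pow | | exact: P_sum].
  exact: poincare_series_sum_classes.
split=> //.
  rewrite /P poincare_seriesE //; apply: fpsP => k /=.
  rewrite dim_invariants_char_dot; congr (_ * _); apply: eq_bigr => g Gg.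
  by rewrite (repr_char_zero hirr Gg) repr_char_triv.
rewrite P0_sum -(sum_class_labelling hc) => [|g x Gg Gx]; last by rewrite repr_charJ.
by congr (_ *: _); apply: eq_bigr => mu _; rewrite scaler_nat.
Qed.
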